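(* Suppose that any controller $i\in\mathcal V$ at any time $t\in\mathbb Z_{\ge0}$ has access to the states in $$\tilde{\mathcal I}_i(t)=\big\{x_j(k):j\in\mathcal V_i,\ k\in\{t-D_{\max}-1,\dots,t-D_{ij}\}\big\}\subseteq\mathcal I_i(t),$$ where $\mathcal V_i=\{j\in\mathcal V:D_{ij}\ne+\infty\}$ and $\mathcal I_i(t)=\{x_j(k):j\in\mathcal V_i,\,0\le k\le t-D_{ij}\}$. Then the following hold for the control algorithm described in the context, for every $i\in\mathcal V$: (a) The memory $\mathcal M_i$ of the algorithm can be recursively updated (i.e. the quantities computed in steps 1 and 2 of each iteration can be determined from the current memory, the states in $\tilde{\mathcal I}_i(t)$, and the recursions (I), (II), (III) of the context) such that at the beginning of any iteration $t\in\{0,\dots,T-1\}$, $$\mathcal M_i=\big\{\hat\zeta_s(k):k\in\{t-2D_{\max}-1,\dots,t-D_{ij}-1\},\,s\in\mathcal L(\mathcal T_i),\,j\in\mathcal V,\,s_j(0)=s\big\}\cup\big\{\hat\zeta_s(t-D_{\max}-1):s\in\mathcal R(\mathcal T_i)\big\}.$$ (b) In any iteration $t\in\{0,\dots,T-1\}$, the control input $\hat u_i(t)$ of step 3 can be determined using recursion (II) and the states in the memory $\mathcal M_i$ after step 2 (and before step 4) of that iteration.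
   Context: Networked system. $\mathcal V=\{1,\dots,p\}$; subsystem $i$ has state $x_i(t)\in\mathbb R^{n_i}$ and input $u_i(t)\in\mathbb R^{m_i}$, $n_i\ge m_i$, with dynamics $x_i(t+1)=\sum_{j\in\mathcal N_i}(A_{ij}x_j(t)+B_{ij}u_j(t))+w_i(t)$, $x(0)=0$, where $\mathcal N_i\subseteq\mathcal V$ is the set of subsystems directly affecting $i$, $A_{ij}\in\mathbb R^{n_i\times n_j}$, $B_{ij}\in\mathbb R^{n_i\times m_j}$; $w(t)$ is white Gaussian noise. Delays. $\mathcal G(\mathcal V,\mathcal A)$ is a directed graph without self loops, each edge with delay $0$ or $1$, with no directed cycle of total delay zero. $D_{ii}=0$; for $i\ne j$, $D_{ij}$ is the smallest total delay of a directed path from $j$ to $i$ ($+\infty$ if none). Standing assumption: $D_{ij}\le1$ for all $i$ and $j\in\mathcal N_i$. $D_{\max}$ is the maximum of $D_{ij}$ over pairs such that there is a directed path from $j$ to $i$ (equivalently over finite $D_{ij}$). Information graph. $s_j(k)=\{i\in\mathcal V:D_{ij}\le k\}$, $\mathcal U=\{s_j(k):k\ge0,j\in\mathcal V\}$, edges $s_j(k)\to s_j(k+1)$. Every $r\in\mathcal U$ has exactly one outgoing edge (possibly a self loop); the graph is a forest of trees oriented toward roots, the roots being the nodes with a self loop. Leaves are the nodes $s_j(0)$, $j\in\mathcal V$. Write $w_j\to r$ iff $r=s_j(0)$ (for such $r$, $j$ is unique). $\mathcal T_i$ is the set of (nodes of) trees whose root contains $i$; $\mathcal L(\mathcal T_i)$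 is the set of leaves in $\mathcal T_i$; $\mathcal R(\mathcal T_i)$ is the set of roots in $\mathcal T_i$, except that an isolated node (a leaf with a self loop) is put in $\mathcal L(\mathcal T_i)$ only. Matrix notation: for $s,r\subseteq\mathcal V$, $M_{sr}$ (or $M_{s,r}$) is the submatrix of block rows $s$ and block columns $r$; $I$ is an identity matrix. Data known to every controller: matrices $\hat A\in\mathbb R^{n\times n}$, $\hat B\in\mathbb R^{n\times m}$ (estimates of $A,B$; $n=\sum n_i$, $m=\sum m_i$), $Q\succeq0$, $R\succ0$, $\mathcal G$, the delays, and gains $\hat K_r$, $r\in\mathcal U$, given (with $r\to s$) by $\hat K_r=-(R_{rr}+\hat B_{sr}^\top\hat P_s\hat B_{sr})^{-1}\hat B_{sr}^\top\hat P_s\hat A_{sr}$, $\hat P_r=Q_{rr}+\hat K_r^\top R_{rr}\hat K_r+(\hat A_{sr}+\hat B_{sr}\hat K_r)^\top\hat P_s(\hat A_{sr}+\hat B_{sr}\hat K_r)$ (a Riccati equation in $\hat P_r$ when $r=s$). Recursions. (I) $\hat u_i(t)=\sum_{r\in\mathcal U,\,r\ni i}I_{\{i\},r}\hat K_r\hat\zeta_r(t)$. (II) $\hat\zeta_r(t+1)=\sum_{v\to r}(\hat A_{rv}+\hat B_{rv}\hat K_v)\hat\zeta_v(t)+\sum_{w_j\to r}I_{r,\{j\}}\hat w_j(t)$. (III) $\hat w_j(t)=0$ for $t<-1$, $\hat w_j(-1)=x_j(0)$, and $\hat w_j(t)=x_j(t+1)-\sum_{l\in\mathcal N_j}(\hat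 A_{jl}x_l(t)+\hat B_{jl}\hat u_l(t))$ for $t\ge0$, where $x$ is the state of the system when the input $u=\hat u$ is applied by all controllers. All states and internal states at negative times are zero. Control algorithm for node $i$ (run by all $i\in\mathcal V$ in parallel; horizon $T$). Initialize $\mathcal M_i=\{\hat\zeta_s(k):k\in\{-2D_{\max}-1,\dots,-D_{ij}-1\},s\in\mathcal L(\mathcal T_i),j\in\mathcal V,s_j(0)=s\}\cup\{\hat\zeta_s(-D_{\max}-1):s\in\mathcal R(\mathcal T_i)\}$ with all these entries equal to $0$. For iteration $t=0,\dots,T-1$: Step 1. For each $s\in\mathcal L(\mathcal T_i)$, taken in an order such that $s_{j_1}(0)$ precedes $s_{j_2}(0)$ whenever $D_{ij_1}>D_{ij_2}$: let $j$ satisfy $s_j(0)=s$; obtain $\hat w_j(t-D_{ij}-1)$ from (III), then $\hat\zeta_s(t-D_{ij})$ from (II), and add $\hat\zeta_s(t-D_{ij})$ to $\mathcal M_i$. Step 2. For each $s\in\mathcal R(\mathcal T_i)$: obtain $\hat\zeta_s(t-D_{\max})$ from (II) and add it to $\mathcal M_i$. Step 3. Apply $\hat u_i(t)$ given by (I). Step 4. Remove from $\mathcal M_i$ the entries $\hat\zeta_s(t-2D_{\max}-1)$, $s\in\mathcal L(\mathcal T_i)$, and $\hat\zeta_s(t-D_{\max}-1)$, $s\in\mathcal R(\mathcal T_i)$. *)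

(* Defs.v *)
From HB Require Import structures.
From mathcomp Require Import all_boot all_order all_algebra.
From mathcomp Require Import all_classical all_reals all_analysis.

Set Implicit Arguments.
Unset Strict Implicit.
Unset Printing Implicit Defensive.

Import Order.TTheory GRing.Theory Num.Theory.

Local Open Scope ring_scope.

(* Block structure. A vector of R^{n_0 + ... + n_(p-1)} is indexed by
   'I_(\sum_i n i); [tagnat.sig1 c] is the block containing coordinate c. For a
   set s of blocks, [enum_val] lists the coordinates of s in increasing order,
   so [subblock M s r] is the submatrix M_{sr} of block rows s and block
   columns r, and blocks of single subsystems are obtained with singletons. *)
Section Blocks.
Variables (R : realType) (p : nat).
Implicit Types (n m : 'I_p -> nat) (s r : {set 'I_p}).

Definition coords n s : {set 'I_(\sum_i n i)} :=
  [set c | tagnat.sig1 c \in s]%SET.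

Definition bdim n s : nat := #|coords n s|.

Definition subblock n m (M : 'M[R]_(\sum_i n i, \sum_i m i)) s r :
    'M[R]_(bdim n s, bdim m r) :=
  \matrix_(a < bdim n s, b < bdim m r)
    M (@enum_val _ (mem (coords n s)) a) (@enum_val _ (mem (coords m r)) b).

Definition subvec n (v : 'cV[R]_(\sum_i n i)) s : 'cV[R]_(bdim n s) :=
  \col_(a < bdim n s) v (@enum_val _ (mem (coords n s)) a) 0.

Definition idblock n s r : 'M[R]_(bdim n s, bdim n r) :=
  subblock (1%:M : 'M[R]_(\sum_i n i)) s r.

End Blocks.

Definition psd (R : realType) n (M : 'M[R]_n) : Prop :=
  M^T = M /\ forall v : 'cV[R]_n, 0 <= (v^T *m M *m v) 0 0.

Definition pd (R : realType) n (M : 'M[R]_n) : Prop :=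
  M^T = M /\ forall v : 'cV[R]_n, v != 0 -> 0 < (v^T *m M *m v) 0 0.

(* [normal_prob m 0] is not a point mass in the library, hence the separate
   degenerate case. *)
Definition gaussian_rv (R : realType) (d : measure_display)
    (Om : measurableType d) (P : probability Om R) (X : Om -> R) : Prop :=
  measurable_fun setT X /\
  exists m s : R, forall E : set R, measurable E ->
    P (X @^-1` E)%classic
    = if s == 0 then dirac m E else normal_prob m s E.

(* A white Gaussian vector process: jointly Gaussian (every finite linear
   combination of its coordinates at finitely many times is Gaussian), zero
   mean, uncorrelated over time, with constant covariance W. *)
Definition white_gaussian (R : realType) (d : measure_display)
    (Om : measurableType d) (P : probability Om R) (N : nat)
    (w : nat -> Om -> 'cV[R]_N) : Prop :=
  [/\ forall (H : nat) (c : 'I_H -> 'rV[R]_N),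
        gaussian_rv P (fun om => \sum_(t < H) (c t *m w t om) 0 0),
      forall t a, ('E_P[fun om => w t om a 0%R] = 0)%E
    & exists W : 'M[R]_N, forall t t' a b,
        ('E_P[fun om => (w t om a 0 * w t' om b 0)%R]
         = (if t == t' then W a b else 0%R)%:E)%E].

(* [arc G j i] is an edge from j to i, and its delay is 1 if [slow G j i] and 0
   otherwise. *)
Record delay_graph (p : nat) := DelayGraph {
  arc : rel 'I_p;
  slow : rel 'I_p
}.

Section Delays.
Variables (p : nat) (G : delay_graph p).
Implicit Types (i j : 'I_p) (r s : {set 'I_p}) (k : nat).

Fixpoint path_delay j (c : seq 'I_p) : nat :=
  if c is l :: c' then (slow G j l + path_delay l c')%N else 0%N.

Definition delay_graph_ok : Prop :=
  (forall j, ~~ arc G j j) /\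
  (forall j c, path (arc G) j c -> c <> [::] -> last j c = j ->
     (0 < path_delay j c)%N).

Definition path_with_delay j i k : Prop :=
  exists c, [/\ path (arc G) j c, last j c = i & path_delay j c = k].

(* The smallest total delay of a directed path from j to i, [None] standing for
   +oo. The empty path gives D_ii = 0. *)
Definition dist i j : option nat :=
  match pselect (exists k, `[< path_with_delay j i k >]) with
  | left ex => Some (ex_minn ex)
  | right _ => None
  end.

Definition dist_le i j k : bool := if dist i j is Some d then (d <= k)%N else false.

(* Infinite distances count for 0, which is harmless since D_ii = 0. *)
Definition dmax : nat := \max_(i < p) \max_(j < p) odflt 0%N (dist i j).

Definition reach j k : {set 'I_p} := [set i | dist_le i j k]%SET.

Definition nodes : {set {set 'I_p}} :=
  [set s | `[< exists j k, s = reach j k >]]%SET.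

Definition edge : rel {set 'I_p} :=
  fun r s => `[< exists j k, r = reach j k /\ s = reach j k.+1 >].

Definition leaves : {set {set 'I_p}} := [set reach j 0 | j : 'I_p]%SET.

Definition roots : {set {set 'I_p}} := [set r in nodes | edge r r]%SET.

Definition trees i : {set {set 'I_p}} :=
  [set r in nodes | [exists q in roots, (i \in q) && connect edge r q]]%SET.

Definition tree_leaves i : {set {set 'I_p}} := (trees i :&: leaves)%SET.

(* A root that is also a leaf counts as a leaf only. *)
Definition tree_roots i : {set {set 'I_p}} := (trees i :&: roots :\: leaves)%SET.

End Delays.

(* What every controller knows. *)
Record problem (R : realType) (p : nat) := Problem {
  sdim : 'I_p -> nat;
  idim : 'I_p -> nat;
  nbrs : 'I_p -> {set 'I_p};
  graph : delay_graph p;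
  Ahat : 'M[R]_(\sum_i sdim i, \sum_i sdim i);
  Bhat : 'M[R]_(\sum_i sdim i, \sum_i idim i);
  Qcost : 'M[R]_(\sum_i sdim i, \sum_i sdim i);
  Rcost : 'M[R]_(\sum_i idim i, \sum_i idim i);
  Khat : forall r : {set 'I_p}, 'M[R]_(bdim idim r, bdim sdim r)
}.

Section Problem.
Variables (R : realType) (p : nat) (pb : problem R p).
Implicit Types (i j l : 'I_p) (r s v : {set 'I_p}).

Local Notation G := (graph pb).
Local Notation vec r := 'cV[R]_(bdim (sdim pb) r).
Local Notation ivec r := 'cV[R]_(bdim (idim pb) r).
Local Notation Ah := (subblock (Ahat pb)).
Local Notation Bh := (subblock (Bhat pb)).
Local Notation Kh := (Khat pb).

Definition problem_ok : Prop :=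
  [/\ forall i, (idim pb i <= sdim pb i)%N,
      delay_graph_ok G,
      forall i j, j \in nbrs pb i -> dist_le G i j 1,
      psd (Qcost pb)
    & pd (Rcost pb)].

(* The membership in [unitmx] makes explicit that the inverse exists; [invmx] is
   total. *)
Definition gains_ok
    (Ph : forall r, 'M[R]_(bdim (sdim pb) r)) : Prop :=
  forall r s, edge G r s ->
    let Rr := subblock (Rcost pb) r r in
    let Qr := subblock (Qcost pb) r r in
    let Hr := Rr + (Bh s r)^T *m Ph s *m Bh s r in
    let F := Ah s r + Bh s r *m Kh r in
    [/\ Hr \in unitmx,
        Kh r = - (invmx Hr *m (Bh s r)^T *m Ph s *m Ah s r)
      & Ph r = Qr + (Kh r)^T *m Rr *m Kh r + F^T *m Ph s *m F].

(* Right-hand sides of the recursions for the input, the internal states and the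
   noise estimates. *)
Definition rhs_input i (z : forall r, vec r) : ivec [set i]%SET :=
  \sum_(r in nodes G | i \in r) idblock R (idim pb) [set i]%SET r *m (Kh r *m z r).

Definition rhs_internal r (z : forall v, vec v) (wh : forall j, vec [set j]%SET) :
    vec r :=
  \sum_(v in nodes G | edge G v r) (Ah r v + Bh r v *m Kh v) *m z v
  + \sum_(j < p | r == reach G j 0) idblock R (sdim pb) r [set j]%SET *m wh j.

Definition rhs_noise j (xnext : vec [set j]%SET) (x : forall l, vec [set l]%SET)
    (u : forall l, ivec [set l]%SET) : vec [set j]%SET :=
  xnext - \sum_(l in nbrs pb j)
            (Ah [set j]%SET [set l]%SET *m x l + Bh [set j]%SET [set l]%SET *m u l).

(* A sample path of the true plant (A, B) driven by the noise w under the inputs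
   u generated by the recursions. *)
Record closed_loop (A : 'M[R]_(\sum_i sdim pb i, \sum_i sdim pb i))
    (B : 'M[R]_(\sum_i sdim pb i, \sum_i idim pb i))
    (w : nat -> 'cV[R]_(\sum_i sdim pb i))
    (x : forall j, int -> vec [set j]%SET)
    (u : forall j, int -> ivec [set j]%SET)
    (wh : forall j, int -> vec [set j]%SET)
    (z : forall r, int -> vec r) : Prop := ClosedLoop {
  cl_state_past : forall j (k : int), k <= 0 -> x j k = 0;
  cl_state : forall i (t : nat),
    x i t.+1%:Z
    = \sum_(j in nbrs pb i)
        (subblock A [set i]%SET [set j]%SET *m x j t%:Z
         + subblock B [set i]%SET [set j]%SET *m u j t%:Z)
      + subvec (w t) [set i]%SET;
  cl_input : forall i k, u i k = rhs_input i (fun r => z r k);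
  cl_internal_past : forall r (k : int), k < 0 -> z r k = 0;
  cl_internal : forall r k, r \in nodes G ->
    z r (k + 1) = rhs_internal r (fun v => z v k) (fun j => wh j k);
  cl_noise_past : forall j (k : int), k < -1 -> wh j k = 0;
  cl_noise_init : forall j, wh j (-1) = x j 0;
  cl_noise : forall j (k : int), 0 <= k ->
    wh j k = rhs_noise (x j (k + 1)) (fun l => x l k) (fun l => u l k)
}.

(* Data held by a controller are labelled values: [LZ r k] labels the internal
   state of node r at time k, and likewise for states, inputs and noise
   estimates. *)
Inductive label :=
  | LX of 'I_p & int
  | LU of 'I_p & int
  | LW of 'I_p & int
  | LZ of {set 'I_p} & int.

Definition ldim (q : label) : nat :=
  match q with
  | LX j _ => bdim (sdim pb) [set j]%SET
  | LU j _ => bdim (idim pb) [set j]%SET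
  | LW j _ => bdim (sdim pb) [set j]%SET
  | LZ r _ => bdim (sdim pb) r
  end.

Definition entry := {q : label & 'cV[R]_(ldim q)}.

Definition xentry j k (v : vec [set j]%SET) : entry :=
  existT (fun q => 'cV[R]_(ldim q)) (LX j k) v.
Definition wentry j k (v : vec [set j]%SET) : entry :=
  existT (fun q => 'cV[R]_(ldim q)) (LW j k) v.
Definition zentry r k (v : vec r) : entry :=
  existT (fun q => 'cV[R]_(ldim q)) (LZ r k) v.

Inductive recursion := RecI | RecII | RecIII.

(* [computes rules S q v]: the value v of the quantity q is obtained from the
   entries in S by finitely many applications of the recursions in [rules],
   where RecI gives inputs, RecII internal states and RecIII noise estimates.
   Apart from S only the common data [pb] enter, in particular neither the true
   plant nor the noise. *)
Inductive computes (rules : set recursion) (S : set entry) :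
    forall q, 'cV[R]_(ldim q) -> Prop :=
  | ComputesKnown q (v : 'cV[R]_(ldim q)) :
      S (existT (fun q => 'cV[R]_(ldim q)) q v) -> computes rules S v
  | ComputesInput i k (z : forall r, vec r) :
      rules RecI ->
      (forall r, r \in nodes G -> i \in r -> @computes rules S (LZ r k) (z r)) ->
      @computes rules S (LU i k) (rhs_input i z)
  | ComputesInternal r k (z : forall v, vec v) (wh : forall j, vec [set j]%SET) :
      rules RecII -> r \in nodes G ->
      (forall v, v \in nodes G -> edge G v r -> @computes rules S (LZ v k) (z v)) ->
      (forall j, r = reach G j 0 -> @computes rules S (LW j k) (wh j)) ->
      @computes rules S (LZ r (k + 1)) (rhs_internal r z wh)
  | ComputesNoisePast j (k : int) :
      rules RecIII -> k < -1 -> @computes rules S (LW j k) 0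
  | ComputesNoiseInit j (v : vec [set j]%SET) :
      rules RecIII -> @computes rules S (LX j 0) v -> @computes rules S (LW j (-1)) v
  | ComputesNoise j (k : int) (xnext : vec [set j]%SET)
        (x : forall l, vec [set l]%SET) (u : forall l, ivec [set l]%SET) :
      rules RecIII -> 0 <= k ->
      @computes rules S (LX j (k + 1)) xnext ->
      (forall l, l \in nbrs pb j -> @computes rules S (LX l k) (x l)) ->
      (forall l, l \in nbrs pb j -> @computes rules S (LU l k) (u l)) ->
      @computes rules S (LW j k) (rhs_noise xnext x u).

Section Controller.
Variable i : 'I_p.
Local Notation Dm := (dmax G).

Definition information (x : forall j, int -> vec [set j]%SET) (t : nat) : set entry :=
  [set e | exists j d (k : int),
     [/\ dist G i j = Some d, 0 <= k <= t%:Z - d%:Z & e = xentry k (x j k)]]%classic.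

Definition accessible (x : forall j, int -> vec [set j]%SET) (t : nat) : set entry :=
  [set e | exists j d (k : int),
     [/\ dist G i j = Some d,
         t%:Z - Dm%:Z - 1 <= k <= t%:Z - d%:Z
       & e = xentry k (x j k)]]%classic.

Definition leaf_memory (z : forall r, int -> vec r) (t : nat) : set entry :=
  [set e | exists s j d (k : int),
     [/\ s \in tree_leaves G i, reach G j 0 = s, dist G i j = Some d,
         t%:Z - 2 * Dm%:Z - 1 <= k <= t%:Z - d%:Z - 1
       & e = zentry k (z s k)]]%classic.

Definition root_memory (z : forall r, int -> vec r) (t : nat) : set entry :=
  [set e | exists s, s \in tree_roots G i /\
     e = zentry (t%:Z - Dm%:Z - 1) (z s (t%:Z - Dm%:Z - 1))]%classic.

Definition memory_at (z : forall r, int -> vec r) (t : nat) : set entry :=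
  (leaf_memory z t `|` root_memory z t)%classic.

Definition initial_memory : set entry := memory_at (fun _ _ => 0) 0.

Definition step1_order (ord : seq {set 'I_p}) : Prop :=
  [/\ uniq ord, ord =i tree_leaves G i
    & forall j1 j2 d1 d2,
        reach G j1 0 \in tree_leaves G i -> reach G j2 0 \in tree_leaves G i ->
        dist G i j1 = Some d1 -> dist G i j2 = Some d2 -> (d2 < d1)%N ->
        (index (reach G j1 0) ord < index (reach G j2 0) ord)%N].

(* X is the set of states accessible in the current iteration. *)
Definition step1_leaf (X : set entry) (t : nat) s (M M' : set entry) : Prop :=
  exists j d (whv : vec [set j]%SET) (zv : vec s),
    [/\ reach G j 0 = s, dist G i j = Some d,
        @computes [set: recursion]%classic (M `|` X)%classic
          (LW j (t%:Z - d%:Z - 1)) whv,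
        @computes [set RecII]%classic
          (M `|` X `|` [set wentry (t%:Z - d%:Z - 1) whv])%classic
          (LZ s (t%:Z - d%:Z)) zv
      & M' = (M `|` [set zentry (t%:Z - d%:Z) zv])%classic].

Fixpoint step1 (X : set entry) (t : nat) (ord : seq {set 'I_p}) (M M' : set entry) :
    Prop :=
  if ord is s :: ord'
  then exists M1, step1_leaf X t s M M1 /\ step1 X t ord' M1 M'
  else M' = M.

(* Every root is treated with the memory left by step 1 only, so that the order
   in which the roots are taken is immaterial. *)
Definition step2 (X : set entry) (t : nat) (M M' : set entry) : Prop :=
  exists z : forall r, vec r,
    (forall s, s \in tree_roots G i ->
       @computes [set RecII]%classic (M `|` X)%classic (LZ s (t%:Z - Dm%:Z)) (z s)) /\
    M' = (M `|` [set e | exists s, s \in tree_roots G i /\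
                   e = zentry (t%:Z - Dm%:Z) (z s)])%classic.

Definition steps12 (X : set entry) (t : nat) (ord : seq {set 'I_p})
    (M M' : set entry) : Prop :=
  exists M1, step1 X t ord M M1 /\ step2 X t M1 M'.

Definition step4 (t : nat) (M : set entry) : set entry :=
  (M `\` [set e | (exists2 s, s \in tree_leaves G i
                     & projT1 e = LZ s (t%:Z - 2 * Dm%:Z - 1)) \/
                  (exists2 s, s \in tree_roots G i
                     & projT1 e = LZ s (t%:Z - Dm%:Z - 1))])%classic.

(* [M t] is the memory at the beginning of iteration t; step 3 leaves it
   unchanged. *)
Definition run (T : nat) (ord : nat -> seq {set 'I_p})
    (x : forall j, int -> vec [set j]%SET) (M : nat -> set entry) : Prop :=
  M 0%N = initial_memory /\
  forall t, (t < T)%N ->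
    exists M2, steps12 (accessible x t) t (ord t) (M t) M2 /\ M t.+1 = step4 t M2.

End Controller.
End Problem.

(* Main.v *)
Require Import Defs.
From HB Require Import structures.
From mathcomp Require Import all_boot all_order all_algebra.
From mathcomp Require Import all_classical all_reals all_analysis.
From mathcomp Require Import zify.

(** A controller that computes by the recursions from true data can only obtain
    true values ([computes_true]). What must be shown is that the data at hand
    suffice.

    The key is the graph of information sets. Edges have delay 0 or 1, so
    s_j(k + 1) is the set of subsystems at distance at most 1 from s_j(k)
    ([reachS]). Consequently, if controller i may know something at time t about a
    node r at time k, in the sense that some l in r has D_il <= t - k, then it may
    know the same about every predecessor v of r at time k - 1. Unrolling
    recursion (II) therefore never requires information that has not yet reached
    i, and it ends at leaves s_j(0) at times k <= t - D_ij, or at a root at time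
    t - D_max - 1. A node that is not a root lies at most D_max levels below its
    root, so the unrolling goes back at most to time t - 2 D_max - 1. These are
    precisely the stored values ([internal_computable]).

    In step 1, the noise estimate of j at time t - D_ij - 1 requires states and
    inputs of the neighbours l of j, for which D_il <= D_ij + 1 by the triangle
    inequality. The states are accessible, and the inputs come from internal states
    covered by the unrolling, provided that the leaves farther away than j have
    already been brought up to date; this is what the order of step 1 ensures
    ([step1_leaf_computable]). Step 2 and the input of step 3 are further instances
    of the unrolling. So each iteration can be carried out, and truth of all
    computed values leaves no choice in its outcome: after step 4 the memory
    consists of the true values in the windows moved by one ([steps12E],
    [step4_after_step2]). *)

Set Implicit Arguments.
Unset Strict Implicit.
Unset Printing Implicit Defensive.

Import Order.TTheory GRing.Theory Num.Theory.

Local Open Scope ring_scope.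

(** * Distances and the information graph *)

Section Graph.
Variables (p : nat) (G : delay_graph p).
Implicit Types (i j l : 'I_p) (r s v : {set 'I_p}) (k m n : nat).

Lemma path_delay_cat j (c1 c2 : seq 'I_p) :
  path_delay G j (c1 ++ c2)
  = (path_delay G j c1 + path_delay G (last j c1) c2)%N.
Proof. by elim: c1 j => //= l c1 IH j; rewrite IH addnA. Qed.

Lemma dist_leP i j k :
  reflect (exists c, [/\ path (Defs.arc G) j c, last j c = i & (path_delay G j c <= k)%N])
          (dist_le G i j k).
Proof.
rewrite /dist_le /dist; case: pselect => [ex|nex]; last first.
  apply: ReflectF => -[c [pc lc _]]; apply: nex.
  by exists (path_delay G j c); apply/asboolP; exists c.
case: ex_minnP => d /asboolP dP dmin; apply: (iffP idP) => [dk|[c' [pc' lc' dc']]].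
  by case: dP => c [pc lc dc]; exists c; rewrite dc.
by apply: leq_trans dc'; apply: dmin; apply/asboolP; exists c'.
Qed.

Lemma dist_le_Some i j d k : dist G i j = Some d -> dist_le G i j k = (d <= k)%N.
Proof. by rewrite /dist_le => ->. Qed.

Lemma dist_le_ex i j k : dist_le G i j k -> exists2 d, dist G i j = Some d & (d <= k)%N.
Proof. by rewrite /dist_le; case: dist => // d; exists d. Qed.

Lemma dist_le_refl i k : dist_le G i i k.
Proof. by apply/dist_leP; exists [::]. Qed.

Lemma dist_le_mono i j k m : (k <= m)%N -> dist_le G i j k -> dist_le G i j m.
Proof. by move=> km; rewrite /dist_le; case: dist => // d /leq_trans; apply. Qed.

Lemma dist_le_trans l i j k m :
  dist_le G i l k -> dist_le G l j m -> dist_le G i j (k + m).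
Proof.
move=> /dist_leP[c [pc lc dc]] /dist_leP[c' [pc' lc' dc']].
apply/dist_leP; exists (c' ++ c).
by rewrite cat_path last_cat path_delay_cat lc' pc' addnC leq_add.
Qed.

(** Otherwise the two paths would close into a cycle of total delay zero. *)
Lemma dist_le0_anti i j :
  delay_graph_ok G -> dist_le G i j 0 -> dist_le G j i 0 -> i = j.
Proof.
move=> [_ nocycle] /dist_leP[c [pc lc dc]] /dist_leP[c' [pc' lc' dc']].
case: (c =P [::]) => [c0|/eqP cN0]; first by rewrite -lc c0.
have := nocycle j (c ++ c'); rewrite cat_path last_cat path_delay_cat lc pc pc' lc'.
move: dc dc'; rewrite !leqn0 => /eqP -> /eqP -> /= /(_ isT) H.
suff : (0 < 0)%N by [].
by apply: H => //; case: c cN0 {pc lc}.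
Qed.

(** Delays of edges are at most one, so the delay along a path does not jump over
    any intermediate value. *)
Lemma dist_le_split i j k :
  dist_le G i j k.+1 -> exists2 l, dist_le G l j k & dist_le G i l 1.
Proof.
move=> /dist_leP[c []]; elim/last_ind: c i => [|c a IH] i.
  by move=> _ <- _; exists j; apply: dist_le_refl.
rewrite rcons_path last_rcons -cats1 path_delay_cat /= addn0 => /andP[pc ea] <- dc.
have step : dist_le G a (last j c) (slow G (last j c) a).
  by apply/dist_leP; exists [:: a]; rewrite /= ea addn0.
have [dck|] := leqP (path_delay G j c) k.
  exists (last j c); first by apply/dist_leP; exists c.
  by apply: dist_le_mono step; case: slow.
move=> kc; have s0 : slow G (last j c) a = false by case: slow dc => //; lia.
rewrite s0 in step; have [|l dl dil] := IH (last j c) pc erefl; first by lia.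
by exists l => //; apply: (dist_le_trans step dil).
Qed.

Lemma dist_leq_dmax i j d : dist G i j = Some d -> (d <= dmax G)%N.
Proof.
move=> dij; rewrite /dmax; apply: leq_trans (leq_bigmax i).
by apply: leq_trans (leq_bigmax j); rewrite dij.
Qed.

Definition nxt r : {set 'I_p} := [set i | [exists l in r, dist_le G i l 1]]%SET.

Lemma in_reach i j k : (i \in reach G j k) = dist_le G i j k.
Proof. by rewrite inE. Qed.

(** The set reached after one more unit of delay depends only on the set already
    reached: this is why a node of the information graph has a single successor. *)
Lemma reachS j k : reach G j k.+1 = nxt (reach G j k).
Proof.
apply/setP => i; rewrite in_reach inE; apply/idP/exists_inP => [|[l]].
  by move=> /dist_le_split[l dl di]; exists l; rewrite ?in_reach.
by rewrite in_reach => dl dil; rewrite -add1n (dist_le_trans dil dl).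
Qed.

Lemma reach_inj j l : delay_graph_ok G -> reach G j 0 = reach G l 0 -> j = l.
Proof.
move=> Gok rjl; apply: (dist_le0_anti Gok); rewrite -in_reach.
  by rewrite -rjl in_reach dist_le_refl.
by rewrite rjl in_reach dist_le_refl.
Qed.

Lemma nodesP r : reflect (exists j k, r = reach G j k) (r \in nodes G).
Proof. by rewrite inE; apply: asboolP. Qed.

Lemma reach_node j k : reach G j k \in nodes G.
Proof. by apply/nodesP; exists j, k. Qed.

Lemma edgeE r s : edge G r s -> s = nxt r.
Proof. by move=> /asboolP[j [k [-> ->]]]; rewrite reachS. Qed.

Lemma edge_next r : r \in nodes G -> edge G r (nxt r).
Proof. by move=> /nodesP[j [k ->]]; apply/asboolP; exists j, k; rewrite reachS. Qed.

Lemma rootE r : (r \in Defs.roots G) = (r \in nodes G) && (nxt r == r).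
Proof.
rewrite inE; have [nr|//] := boolP (r \in nodes G); rewrite /=.
apply/idP/eqP => [/edgeE <- //|rr]; by rewrite -{2}rr edge_next.
Qed.

Lemma iter_nxt_reach n j k : iter n nxt (reach G j k) = reach G j (n + k).
Proof. by elim: n => //= n ->; rewrite -reachS addSn. Qed.

Lemma iter_nxt_root r n : r \in Defs.roots G -> iter n nxt r = r.
Proof. by rewrite rootE => /andP[_ /eqP rr]; elim: n => //= n ->. Qed.

(** Beyond the largest finite delay a reachable set no longer grows. *)
Lemma reach_root j k : (dmax G <= k)%N -> reach G j k \in Defs.roots G.
Proof.
move=> dk; rewrite rootE reach_node -reachS; apply/eqP/setP => i.
rewrite !in_reach; apply/idP/idP; last exact: dist_le_mono.
move=> /dist_le_ex[d dij _]; rewrite (dist_le_Some _ dij).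
exact: leq_trans (dist_leq_dmax dij) dk.
Qed.

Lemma iter_dmax_root r : r \in nodes G -> iter (dmax G) nxt r \in Defs.roots G.
Proof.
by move=> /nodesP[j [k ->]]; rewrite iter_nxt_reach reach_root ?leq_addr.
Qed.

Lemma connect_reach r q : connect (edge G) r q -> exists n, q = iter n nxt r.
Proof.
move=> /connectP[c pc ->]; elim: c r pc => [|v c IH] r /=; first by exists 0%N.
by move=> /andP[/edgeE -> /IH[n ->]]; exists n.+1; rewrite iterSr.
Qed.

(** The tree containing s_j(0) has the set of all subsystems reachable from j as
    its root. *)
Lemma tree_leaf_dist i j :
  (reach G j 0 \in tree_leaves G i) = (dist G i j != None).
Proof.
apply/idP/idP => [|].
  rewrite inE => /andP[]; rewrite inE => /andP[_ /exists_inP[q _ /andP[iq]]] + _.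
  move=> /connect_reach[n qE]; move: iq; rewrite qE iter_nxt_reach in_reach.
  by move=> /dist_le_ex[d ->].
case dij: dist => [d|//] _; rewrite inE; apply/andP; split; last exact: imset_f.
rewrite inE reach_node /=; apply/exists_inP; exists (reach G j (dmax G)).
  exact: reach_root.
rewrite in_reach (dist_le_Some _ dij) (dist_leq_dmax dij) /=.
elim: (dmax G) => [|n IH]; first exact: connect0.
apply: connect_trans IH (connect1 _).
by rewrite reachS edge_next // reach_node.
Qed.

(** A root is a fixed point of [nxt], so it absorbs any number of further unit
    delays. *)
Lemma root_closed r i l k : r \in Defs.roots G -> l \in r -> dist_le G i l k -> i \in r.
Proof.
move=> rr lr dil; have /nodesP[j [m rE]]: r \in nodes G.
  by move: rr; rewrite rootE => /andP[].
rewrite -(iter_nxt_root k rr) rE iter_nxt_reach in_reach.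
by apply: dist_le_trans dil _; rewrite -in_reach -rE.
Qed.

Lemma tree_rootP i r :
  r \in tree_roots G i ->
  [/\ r \in nodes G, r \in Defs.roots G, r \notin leaves G & i \in r].
Proof.
rewrite finset.in_setD => /andP[rl]; rewrite inE => /andP[]; rewrite inE.
move=> /andP[rn /exists_inP[q _ /andP[iq /connect_reach[n qE]]]] rr.
by split=> //; move: iq; rewrite qE iter_nxt_root.
Qed.

Lemma in_tree_roots i r :
  r \in Defs.roots G -> r \notin leaves G -> i \in r -> r \in tree_roots G i.
Proof.
move=> rr rl ir; have rn : r \in nodes G by move: rr; rewrite rootE => /andP[].
rewrite finset.in_setD rl /= inE rr andbT inE rn /=.
by apply/exists_inP; exists r; rewrite ?ir ?connect0.
Qed.

End Graph.

(** * Values obtained from the recursions *)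

Section ClosedLoop.
Variables (R : realType) (p : nat) (pb : problem R p).
Local Notation G := (graph pb).
Local Notation Dm := (dmax (graph pb)).
Local Notation sdim := (sdim pb).
Local Notation idim := (idim pb).
Variables (A : 'M[R]_(\sum_i sdim i, \sum_i sdim i))
  (B : 'M[R]_(\sum_i sdim i, \sum_i idim i)) (w : nat -> 'cV[R]_(\sum_i sdim i)).
Variables (x : forall j : 'I_p, int -> 'cV[R]_(bdim sdim [set j]%SET))
  (u : forall j : 'I_p, int -> 'cV[R]_(bdim idim [set j]%SET))
  (wh : forall j : 'I_p, int -> 'cV[R]_(bdim sdim [set j]%SET))
  (z : forall r : {set 'I_p}, int -> 'cV[R]_(bdim sdim r)).
Hypothesis loop : closed_loop A B w x u wh z.
Hypothesis Gok : delay_graph_ok G.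
Hypothesis nbrs_close : forall j l, l \in nbrs pb j -> dist_le G j l 1.
Implicit Types (j l : 'I_p) (r s v : {set 'I_p}) (S M X : set (entry pb)).

Definition true_value (q : label p) : 'cV[R]_(ldim pb q) :=
  match q with
  | LX j k => x j k
  | LU j k => u j k
  | LW j k => wh j k
  | LZ r k => z r k
  end.

Definition truthful S := forall e, S e -> projT2 e = true_value (projT1 e).

(** A trajectory of the closed loop satisfies each recursion, so a derivation that
    starts from true values can only end in true values. This yields all the
    uniqueness claims: the runs of the algorithm are determined as sets of
    entries, and at most one value of the input can be obtained. *)
Lemma computes_true rules S q (v : 'cV[R]_(ldim pb q)) :
  truthful S -> computes rules S v -> v = true_value q.
Proof.
move=> trueS; elim=> {q v} [q v /trueS //|i k zz _ _ IH|r k zz ww _ rn _ IHz _ IHw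
  |j k _ kn|j v _ _ IH|j k xn xx uu _ k0 _ IHn _ IHx _ IHu] /=.
- by rewrite (cl_input loop); apply: eq_bigr => r /andP[rn ir]; rewrite IH.
- rewrite (cl_internal loop _ rn); congr (_ + _).
    by apply: eq_bigr => v /andP[vn vr]; rewrite IHz.
  by apply: eq_bigr => j /eqP rj; rewrite IHw.
- by rewrite (cl_noise_past loop).
- by rewrite (cl_noise_init loop).
- rewrite (cl_noise loop) //; rewrite /rhs_noise IHn /=; congr (_ - _).
  by apply: eq_bigr => l ln; rewrite IHx // IHu.
Qed.

Lemma computes_internal (rules : set recursion) S r k :
  rules RecII -> r \in nodes G ->
  (forall v, v \in nodes G -> edge G v r ->
     @computes _ _ pb rules S (LZ v (k - 1)) (z v (k - 1))) ->
  (forall j, r = reach G j 0 ->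
     @computes _ _ pb rules S (LW j (k - 1)) (wh j (k - 1))) ->
  @computes _ _ pb rules S (LZ r k) (z r k).
Proof.
move=> rII rn zc wc; have -> : k = k - 1 + 1 by rewrite subrK.
by rewrite (cl_internal loop _ rn); apply: ComputesInternal.
Qed.

Lemma computes_input (rules : set recursion) S i k :
  rules RecI ->
  (forall r, r \in nodes G -> i \in r -> @computes _ _ pb rules S (LZ r k) (z r k)) ->
  @computes _ _ pb rules S (LU i k) (u i k).
Proof. by move=> rI zc; rewrite (cl_input loop); apply: ComputesInput. Qed.

(** * Reconstruction by one controller *)

Section Controller.
Variable i : 'I_p.

(** Recursion (II) is unrolled towards the leaves. If r contains l with
    D_il <= t - k, then a predecessor v of r contains some l' with D_ll' <= 1,
    hence D_il' <= t - (k - 1), so the same condition holds for v at time k - 1.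
    At a leaf r = s_j(0) one has D_lj = 0, so D_ij <= t - k and the value is
    stored, while a root is unrolled only until its stored value at time
    t - D_max - 1. The bound K lets the lemma apply to memories in which some
    leaves have already been brought up to date and others have not. *)
Lemma internal_computable (rules : set recursion) S (t K : int) r (k : int) l (b : nat) :
  rules RecII ->
  (forall j d (k : int), dist G i j = Some d ->
     t - 2 * Dm%:Z - 1 <= k <= t - d%:Z -> k <= K ->
     S (zentry k (z (reach G j 0) k))) ->
  (forall r, r \in tree_roots G i ->
     S (zentry (t - Dm%:Z - 1) (z r (t - Dm%:Z - 1)))) ->
  r \in nodes G -> l \in r -> dist_le G i l b ->
  k <= t - b%:Z -> k <= K -> t - Dm%:Z - 1 <= k ->
  @computes _ _ pb rules S (LZ r k) (z r k).
Proof.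
move=> rII leafS rootS rn lr dil kb kK kDm.
(* Unrolling leaves the time window k >= t - D_max - 1 on nodes that are not
   roots, by as many steps as the node lies below its root. Since this height is
   at most D_max, the stored times k >= t - 2 D_max - 1 suffice for the leaves,
   and the recursion stops. *)
have {kDm} : forall n, iter n (nxt G) r \in Defs.roots G -> t - Dm%:Z - 1 <= k + n%:Z.
  by move=> n _; lia.
have [N] : exists N : nat, k - (t - 2 * Dm%:Z - 1) < N%:Z.
  by exists (absz (k - (t - 2 * Dm%:Z - 1))%R).+1; lia.
elim: N r k l b rn lr dil kb kK => [|N IH] r k l b rn lr dil kb kK kN height.
  by have := height _ (iter_dmax_root rn); lia.
have [/imsetP[j _ rE]|rl] := boolP (r \in leaves G).
  have : dist_le G i j b.
    by rewrite -(addn0 b) (dist_le_trans dil) // -in_reach -rE.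
  move=> /dist_le_ex[d dij db]; rewrite rE; apply: ComputesKnown.
  apply: leafS dij _ kK; have := height _ (iter_dmax_root rn); lia.
have [/andP[rr /eqP ->]|notmem] := boolP ((r \in Defs.roots G) && (k == t - Dm%:Z - 1)).
  by apply: ComputesKnown; apply: rootS; apply: in_tree_roots (root_closed rr lr dil).
apply: computes_internal => // [v vn vr|j rE]; last first.
  by rewrite rE imset_f in rl.
have rv := edgeE vr; move: (lr); rewrite rv inE => /exists_inP[l' l'v dll'].
apply: (IH v (k - 1) l' (b + 1)%N) => //.
- exact: dist_le_trans dil dll'.
- lia.
- lia.
- lia.
- case=> [|n] vroot.
    (* A predecessor that is a root is r itself, and k is not the stored time. *)
    have rE : r = v by rewrite rv; move: vroot; rewrite rootE => /andP[_ /eqP].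
    move: notmem; rewrite rE vroot /= => kne.
    by have := height 0%N; rewrite rE /= => /(_ vroot); lia.
  by move: vroot; rewrite iterSr -rv => /height; lia.
Qed.

(** * The memory during an iteration *)

(** The memory in the course of step 1, once the leaves in [done] have been
    processed. *)
Definition updated (t : nat) (done : seq {set 'I_p}) : set (entry pb) :=
  (memory_at i z t `|` [set e | exists s j d,
     [/\ s \in done, reach G j 0 = s, dist G i j = Some d
       & e = zentry (t%:Z - d%:Z) (z s (t%:Z - d%:Z))]])%classic.

Lemma accessible_true t : truthful (accessible i x t).
Proof. by move=> e [j [d [k [_ _ ->]]]]. Qed.

Lemma updated_true t done : truthful (updated t done).
Proof.
move=> e [[|]|].
- by move=> [s [j [d [k [_ _ _ _ ->]]]]].
- by move=> [s [_ ->]].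
- by move=> [s [j [d [_ _ _ ->]]]].
Qed.

Lemma truthfulU S S' : truthful S -> truthful S' -> truthful (S `|` S')%classic.
Proof. by move=> tS tS' e [/tS|/tS']. Qed.

Lemma truthful1 q :
  truthful [set existT (fun q => 'cV[R]_(ldim pb q)) q (true_value q)]%classic.
Proof. by move=> e ->. Qed.

(** Zero delay in both directions is impossible between distinct subsystems, so a
    leaf determines the subsystem, hence the time of the value added for it. *)
Lemma updated_rcons t done j d :
  dist G i j = Some d ->
  (updated t done `|`
     [set zentry (t%:Z - d%:Z) (z (reach G j 0) (t%:Z - d%:Z))])%classic
  = updated t (rcons done (reach G j 0)).
Proof.
move=> dij; apply/seteqP; split=> e.
  move=> [[M|[s [j' [d' [sd rj' dj' ->]]]]]|->]; first by left.
    by right; exists s, j', d'; rewrite mem_rcons inE sd orbT.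
  by right; exists (reach G j 0), j, d; rewrite mem_rcons mem_head.
move=> [M|[s [j' [d' [+ rj' dj' ->]]]]]; first by left; left.
rewrite mem_rcons inE => /orP[/eqP sE|sd].
  right; rewrite /= -sE; suff -> : d = d' by [].
  by move: dij; rewrite -(reach_inj Gok (etrans rj' sE)) dj' => -[->].
by left; right; exists s, j', d'.
Qed.

Lemma step1_leafE t s done M' :
  step1_leaf i (accessible i x t) t s (updated t done) M' ->
  M' = updated t (rcons done s).
Proof.
move=> [j [d [whv [zv [sE dij cw cz ->]]]]].
have trueMX := truthfulU (@updated_true t done) (@accessible_true t).
have whE := computes_true trueMX cw.
have zE : zv = z s (t%:Z - d%:Z).
  apply: (computes_true _ cz); apply: truthfulU trueMX _; rewrite whE.
  exact: truthful1.
by rewrite zE -sE updated_rcons.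
Qed.

Lemma step1E t ord done M' :
  step1 i (accessible i x t) t ord (updated t done) M' ->
  M' = updated t (done ++ ord).
Proof.
elim: ord done => [|s ord IH] done /=; first by rewrite cats0.
by move=> [M1 [/step1_leafE -> /IH ->]]; rewrite cat_rcons.
Qed.

Definition after_step2 (t : nat) (ord : seq {set 'I_p}) : set (entry pb) :=
  (updated t ord `|` [set e | exists s, s \in tree_roots G i /\
      e = zentry (t%:Z - Dm%:Z) (z s (t%:Z - Dm%:Z))])%classic.

Lemma updated_nil t : updated t [::] = memory_at i z t.
Proof.
apply/seteqP; split=> e; last by left.
by move=> [//|[s [j [d []]]]].
Qed.

Lemma steps12E t ord M' :
  steps12 i (accessible i x t) t ord (memory_at i z t) M' -> M' = after_step2 t ord.
Proof.
rewrite -updated_nil => -[M1 [/step1E -> [zz [cz ->]]]].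
have trueMX := truthfulU (@updated_true t ord) (@accessible_true t).
congr (_ `|` _)%classic; apply/seteqP; split=> e [s [sr ->]]; exists s; split=> //;
  by rewrite (computes_true trueMX (cz s sr)).
Qed.

(** Let D_ij = d, so that the missing value of the leaf s = s_j(0) is the one at
    time t - d, and put k = t - d - 1. Every neighbour l of j satisfies
    D_il <= d + 1 = t - k; hence x_l(k) is accessible, and
    [internal_computable] gives the internal states that enter u_l(k). The order
    of the leaves matters exactly here: subsystems farther from i than j must be
    known up to one step later than what the memory holds at the beginning of the
    iteration, and they have been processed before j. A leaf may also have
    predecessors in the information graph; each of them contains some l with
    D_jl <= 1, so the same estimate applies to them. *)
Lemma step1_leaf_computable t ord done s :
  step1_order pb i (done ++ s :: ord) ->
  step1_leaf i (accessible i x t) t s (updated t done) (updated t (rcons done s)).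
Proof.
case=> ordU ordE ordD.
have sl : s \in tree_leaves G i by rewrite -ordE mem_cat mem_head orbT.
have [j _ sE] : exists2 j, j \in 'I_p & s = reach G j 0.
  by apply/imsetP; move: sl; rewrite inE => /andP[].
have : dist G i j != None by rewrite -tree_leaf_dist -sE.
case dij: dist => [d|//] _.
have dDm := dist_leq_dmax dij.
set X := accessible i x t; set k : int := t%:Z - d%:Z - 1.
have leafS : forall j' d' k', dist G i j' = Some d' ->
    t%:Z - 2 * Dm%:Z - 1 <= k' <= t%:Z - d'%:Z -> k' <= k ->
    updated t done (zentry k' (z (reach G j' 0) k')).
  move=> j' d' k' dij' k'b k'k.
  have j'l : reach G j' 0 \in tree_leaves G i by rewrite tree_leaf_dist dij'.
  have [k'le|k'gt] := lerP k' (t%:Z - d'%:Z - 1).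
    by left; left; exists (reach G j' 0), j', d', k'; split=> //; lia.
  (* Only the newest value t - D_ij' is left. As it is not later than t - d - 1,
     j' is farther than j and its leaf precedes s. *)
  have -> : k' = t%:Z - d'%:Z by lia.
  right; exists (reach G j' 0), j', d'; split=> //.
  have := ordD j' j d' d j'l; rewrite -sE => /(_ sl dij' dij).
  have sd : s \notin done.
    by move: ordU; rewrite cat_uniq /= => /and3P[_ /norP[]].
  rewrite !index_cat (negPf sd) /= eqxx addn0; case: ifP => // _ H.
  have := H _; lia.
have rootS : forall r, r \in tree_roots G i ->
    updated t done (zentry (t%:Z - Dm%:Z - 1) (z r (t%:Z - Dm%:Z - 1))).
  by move=> r rr; left; right; exists r.
have zc (rules : set recursion) S : rules RecII -> (updated t done `<=` S)%classic ->
    forall r l, r \in nodes G -> l \in r -> dist_le G i l d.+1 ->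
    @computes _ _ pb rules S (LZ r k) (z r k).
  move=> rII sub r l rn lr dil.
  apply: (@internal_computable _ _ t%:Z k _ _ l d.+1) => //.
  - by move=> j' d' k' a b c; apply/sub/(leafS _ _ _ a b c).
  - by move=> r' /rootS/sub.
  - by rewrite /k; lia.
  - by rewrite /k; lia.
have wc : @computes _ _ pb [set: recursion]%classic (updated t done `|` X)%classic
    (LW j k) (wh j k).
  have Xj : (updated t done `|` X)%classic (xentry (k + 1) (x j (k + 1))).
    by right; exists j, d, (k + 1); split=> //; rewrite /k; lia.
  have [k_lt|] := ltrP k (-1).
    by rewrite (cl_noise_past loop) //; apply: ComputesNoisePast.
  rewrite le_eqVlt => /predU1P[k1|k_gt].
    rewrite -k1 (cl_noise_init loop); apply: ComputesNoiseInit => //.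
    by apply: ComputesKnown; move: Xj; rewrite -k1 addNr.
  have k0 : 0 <= k by lia.
  rewrite (cl_noise loop) //; apply: ComputesNoise => //.
  - exact: ComputesKnown.
  - move=> l /nbrs_close djl; apply: ComputesKnown; right.
    have /dist_le_ex[d' dil d'd] : dist_le G i l (d + 1).
      by apply: dist_le_trans djl; rewrite (dist_le_Some _ dij).
    by exists l, d', k; split=> //; rewrite /k; lia.
  - move=> l /nbrs_close djl; apply: computes_input => // r rn lr.
    apply: (zc _ _ _ _ _ l) => //.
    by rewrite -addn1; apply: dist_le_trans djl; rewrite (dist_le_Some _ dij).
exists j, d, (wh j k), (z s (t%:Z - d%:Z)); split=> //.
- apply: computes_internal => //.
  + by rewrite sE reach_node.
  + move=> v vn vs; have sv := edgeE vs.
    have : j \in s by rewrite sE in_reach dist_le_refl.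
    rewrite sv inE => /exists_inP[l lv djl].
    apply: (zc _ _ _ _ _ l) => //; first by move=> e; left; left.
    by rewrite -addn1; apply: dist_le_trans djl; rewrite (dist_le_Some _ dij).
  + move=> j'; rewrite sE => /(reach_inj Gok) <-.
    by apply: ComputesKnown; right.
- by rewrite sE updated_rcons.
Qed.

Lemma step1_computable t ord done :
  step1_order pb i (done ++ ord) ->
  step1 i (accessible i x t) t ord (updated t done) (updated t (done ++ ord)).
Proof.
elim: ord done => [|s ord IH] done ordok /=; first by rewrite cats0.
exists (updated t (rcons done s)); split; first exact: step1_leaf_computable ordok.
by rewrite -cat_rcons; apply: IH; rewrite cat_rcons.
Qed.

(** A root s in question contains i, so each of its predecessors contains some l
    with D_il <= 1, and the values at time t - D_max - 1 from which s is updated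
    are old enough for [internal_computable]. *)
Lemma steps12_computable t ord :
  step1_order pb i ord ->
  steps12 i (accessible i x t) t ord (memory_at i z t) (after_step2 t ord).
Proof.
move=> ordok; exists (updated t ord); split.
  by rewrite -updated_nil; exact: (@step1_computable t ord [::]).
exists (fun s => z s (t%:Z - Dm%:Z)); split=> // s /tree_rootP[sn sr sl si].
apply: computes_internal => // [v vn vs|j sE]; last by rewrite sE imset_f in sl.
have := si; rewrite (edgeE vs) inE => /exists_inP[l lv dil].
apply: (@internal_computable _ _ t%:Z (t%:Z - Dm%:Z - 1) _ _ l 1) => //.
- move=> j d k dij kb kK; left; left; left.
  exists (reach G j 0), j, d, k; split=> //; first by rewrite tree_leaf_dist dij.
  have dDm := dist_leq_dmax dij.
  lia.
- by move=> r rr; left; left; right; exists r.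
- lia.
Qed.

(** The stored windows of leaves and roots both move by one time step. No value at
    a leaf is removed by the clause for roots or conversely, since a root that is
    a leaf is treated as a leaf. *)
Lemma step4_after_step2 t ord :
  ord =i tree_leaves G i -> step4 i t (after_step2 t ord) = memory_at i z t.+1.
Proof.
move=> ordE; apply/seteqP; split=> e.
  move=> [[[[H|H]|H]|H] notold]; move: H.
  - move=> [s [j [d [k [sl rj dij kb eE]]]]].
    left; exists s, j, d, k; split=> //.
    have : k <> t%:Z - 2 * Dm%:Z - 1.
      by move=> kE; apply: notold; left; exists s => //; rewrite eE kE.
    lia.
  - by move=> [s [sr eE]]; case: notold; right; exists s; rewrite ?eE.
  - move=> [s [j [d [+ rj dij ->]]]]; rewrite ordE => sl.
    have dDm := dist_leq_dmax dij.
    by left; exists s, j, d, (t%:Z - d%:Z); split=> //; lia.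
  - move=> [s [sr ->]]; right; exists s; split=> //.
    by have -> : t.+1%:Z - Dm%:Z - 1 = t%:Z - Dm%:Z by lia.
have disj s : s \in tree_leaves G i -> s \notin tree_roots G i.
  by move=> sl; apply/negP => /tree_rootP[_ _ /negP[]]; move: sl; rewrite inE => /andP[].
move=> [[s [j [d [k [sl rj dij kb ->]]]]]|[s [sr ->]]]; split.
- have [->|kne] := eqVneq k (t%:Z - d%:Z).
    by left; right; exists s, j, d; rewrite ordE.
  by left; left; left; exists s, j, d, k; split=> //; lia.
- move=> [[s' _ [_ kE]]|[s' s'r [sE _]]]; first by lia.
  by move: (disj _ sl); rewrite sE s'r.
- right; exists s; split=> //.
  by have -> : t.+1%:Z - Dm%:Z - 1 = t%:Z - Dm%:Z by lia.
- move=> [[s' s'l [sE _]]|[s' _ [_ kE]]]; last by lia.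
  by move: (disj _ s'l); rewrite -sE sr.
Qed.

(** All times in the initial memory are negative, where the internal states
    vanish. *)
Lemma initial_memoryE : initial_memory i = memory_at i z 0.
Proof.
have z0 r k : k < 0 -> z r k = 0 by exact: (cl_internal_past loop).
apply/seteqP; split=> e [].
- move=> [s [j [d [k [sl rj dij kb ->]]]]]; left; exists s, j, d, k.
  by split=> //; rewrite z0 //; lia.
- by move=> [s [sr ->]]; right; exists s; rewrite z0 //; lia.
- move=> [s [j [d [k [sl rj dij kb ->]]]]]; left; exists s, j, d, k.
  by split=> //; rewrite z0 //; lia.
- by move=> [s [sr ->]]; right; exists s; rewrite z0 //; lia.
Qed.

(** The input of subsystem i needs z_r(t) for the nodes r containing i itself, and
    D_ii = 0: all leaves are now stored up to time t - D_ij. *)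
Lemma input_computable t ord :
  ord =i tree_leaves G i ->
  @computes _ _ pb [set RecI; RecII]%classic (after_step2 t ord) (LU i t%:Z) (u i t%:Z).
Proof.
move=> ordE; apply: computes_input => [|r rn ir]; first by left.
apply: (@internal_computable _ _ t%:Z t%:Z _ _ i 0) => //.
- by right.
- move=> j d k dij kb _.
  have jl : reach G j 0 \in tree_leaves G i by rewrite tree_leaf_dist dij.
  have [->|kne] := eqVneq k (t%:Z - d%:Z).
    by left; right; exists (reach G j 0), j, d; rewrite ordE.
  by left; left; left; exists (reach G j 0), j, d, k; split=> //; lia.
- by move=> r' rr; left; left; right; exists r'.
- exact: dist_le_refl.
- lia.
- lia.
Qed.

Lemma after_step2_true t ord : truthful (after_step2 t ord).
Proof.
by apply: truthfulU => [|e [s [_ ->]] //]; apply: updated_true.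
Qed.

End Controller.
End ClosedLoop.

Theorem proposition2 (R : realType) (p : nat) (pb : problem R p)
    (Ph : forall r : {set 'I_p}, 'M[R]_(bdim (sdim pb) r))
    (d : measure_display) (Om : measurableType d) (P : probability Om R)
    (A : 'M[R]_(\sum_i sdim pb i, \sum_i sdim pb i))
    (B : 'M[R]_(\sum_i sdim pb i, \sum_i idim pb i))
    (w : nat -> Om -> 'cV[R]_(\sum_i sdim pb i))
    (pb_ok : problem_ok pb) (K_ok : gains_ok Ph)
    (w_white : white_gaussian P w)
    (om : Om)
    (x : forall j : 'I_p, int -> 'cV[R]_(bdim (sdim pb) [set j]%SET))
    (u : forall j : 'I_p, int -> 'cV[R]_(bdim (idim pb) [set j]%SET))
    (wh : forall j : 'I_p, int -> 'cV[R]_(bdim (sdim pb) [set j]%SET))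
    (z : forall r : {set 'I_p}, int -> 'cV[R]_(bdim (sdim pb) r))
    (xu_loop : closed_loop A B (fun t => w t om) x u wh z)
    (i : 'I_p) (T : nat) (ord : nat -> seq {set 'I_p})
    (ord_ok : forall t, (t < T)%N -> step1_order pb i (ord t)) :
  (* the accessible states, except the zero ones at negative times, belong to
     the full information set *)
  (forall (t : nat) (j : 'I_p) (k : int)
      (v : 'cV[R]_(bdim (sdim pb) [set j]%SET)),
     0 <= k -> accessible i x t (xentry k v) -> information i x t (xentry k v)) /\
  (* (a) *)
  ((exists M, run i T ord x M) /\
   (forall M, run i T ord x M ->
      forall t, (t < T)%N -> M t = memory_at i z t)) /\
  (* (b) *)
  (forall M, run i T ord x M ->
     forall t, (t < T)%N ->
     forall M2, steps12 i (accessible i x t) t (ord t) (M t) M2 ->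
     forall v : 'cV[R]_(bdim (idim pb) [set i]%SET),
       @computes R p pb [set RecI; RecII]%classic M2 (LU i t%:Z) v
       <-> v = u i t%:Z).

Proof.
have [_ Gok nbrs_close _ _] := pb_ok.
have memE M : run i T ord x M -> forall t, (t < T)%N -> M t = memory_at i z t.
  move=> [M0 Mstep]; elim=> [|t IH] tT.
    by rewrite M0 (initial_memoryE xu_loop).
  have [M2 [M12 ->]] := Mstep t (ltnW tT).
  rewrite (IH (ltnW tT)) in M12.
  have [_ ordE _] := ord_ok t (ltnW tT).
  by rewrite (steps12E xu_loop Gok M12) (step4_after_step2 z t ordE).
split.
  move=> t j k v k0 [j' [d' [k' [dij' kb vE]]]]; exists j', d', k'; split=> //.
  have : projT1 (xentry k v) = projT1 (xentry k' (x j' k')) by rewrite vE.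
  by move=> /= [_ kk']; lia.
split; first split=> //.
  exists (memory_at i z); split; first by rewrite (initial_memoryE xu_loop).
  move=> t tT; have [_ ordE _] := ord_ok t tT.
  exists (after_step2 z i t (ord t)); rewrite (step4_after_step2 z t ordE); split=> //.
  exact: (steps12_computable xu_loop Gok nbrs_close t (ord_ok t tT)).
move=> M runM t tT M2; rewrite (memE M runM t tT) => /(steps12E xu_loop Gok) -> v.
have [_ ordE _] := ord_ok t tT; split=> [cv|->].
  exact: (computes_true xu_loop (@after_step2_true _ _ _ x u wh z i t (ord t)) cv).
exact: (input_computable xu_loop t ordE).
Qed.
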